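(* Let $\alpha: I\to\mathbb{R}^3$ be a slant helix parametrized by arc-length $s$, with nowhere vanishing curvature, unit principal normal vector $N$ and unit Darboux vector $C$. Let $\sigma=\int_0^s\|N'(s)\|\,ds$ be the arc-length parameter of the principal normal indicatrix of $\alpha$, and regard $N$ and $C$ as functions of $\sigma$. Let $a,\theta$ be constant real numbers (with $\cot\theta$ defined), let $c\in\mathbb{R}^3$ be a constant vector, and let $\sigma_0$ be a fixed parameter value. Then $$\tilde\gamma_N(\sigma)=a\int_{\sigma_0}^{\sigma}N(\sigma)\,d\sigma+a\cot\theta\int_{\sigma_0}^{\sigma}C(\sigma)\,d\sigma+c$$ is both a Bertrand curve and a circular helix.
   Context: For a unit speed curve $\alpha$ in $\mathbb{R}^3$: $T=\alpha'$, the curvature is $\kappa=\|\alpha''\|$, and where $\kappa\neq0$ the unit principal normal $N$ is defined by $\alpha''=\kappa N$ and the unit binormal is $B=T\times N$. The torsion $\tau$ is defined by the Frenet-Serret formulae $T'=\kappa N$, $N'=-\kappa T+\tau B$, $B'=-\tau N$. The Darboux vector field is $W=\tau T+\kappa B$ and the unit Darboux vector is $C=W/\|W\|=\dfrac{\tau T+\kappa B}{\sqrt{\tau^2+\kappa^2}}$. The principal normal indicatrix $(N)$ is the curve on the unit sphere $\mathbb{S}^2$ traced by $N(s)$. A slant helix is a curve with $\kappa\neq0$ whose principal normal lines make a constant angle with a fixed direction; equivalently, $\dfrac{\kappa^2}{(\kappa^2+\tau^2)^{3/2}}\left(\dfrac{\tau}{\kappa}\right)'$ is a constant function. A circular helix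 is a curve for which both $\kappa$ and $\tau$ are non-zero constants. Convention: curves are regular and, wherever the Frenet frame is used, have nowhere vanishing curvature; this applies also to the curve $\tilde\gamma_N$ (i.e. $a,\theta$ are such that it is a regular curve with nonvanishing curvature). A Bertrand curve is a curve in $\mathbb{R}^3$ which shares its principal normals with another curve (its Bertrand mate). The characterization used in the paper: a curve with curvature $\kappa$ and torsion $\tau$ is a Bertrand curve if and only if there exist non-zero real numbers $A,B$ such that $A\kappa+B\tau=1$ at every parameter value.
   Formalization: The circular helix conclusion is proved only when the curve is not planar; e.g. for α a circular helix and θ=π/2 the curve is a circle with zero torsion, so the claim as stated fails there. The Bertrand conclusion is unconditional. *)

(* Defs.v *)
(* Stdlib reals with Coquelicot. *)
From Stdlib Require Import Reals.
From Coquelicot Require Import Coquelicot.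
Open Scope R_scope.

(* Euclidean 3-space; [plus], [scal] and [zero] are the operations of
   Coquelicot's product module. *)
Definition vec : Type := (R * R * R)%type.

Definition cx (v : vec) : R := fst (fst v).
Definition cy (v : vec) : R := snd (fst v).
Definition cz (v : vec) : R := snd v.

Definition dot (u v : vec) : R := cx u * cx v + cy u * cy v + cz u * cz v.

Definition cross (u v : vec) : vec :=
  (cy u * cz v - cz u * cy v,
   cz u * cx v - cx u * cz v,
   cx u * cy v - cy u * cx v).

Definition enorm (v : vec) : R := sqrt (dot v v).

Definition vderive (f : R -> vec) (t : R) : vec :=
  (Derive (fun u => cx (f u)) t,
   Derive (fun u => cy (f u)) t,
   Derive (fun u => cz (f u)) t).

Definition vint (f : R -> vec) (a b : R) : vec :=
  (RInt (fun u => cx (f u)) a b,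
   RInt (fun u => cy (f u)) a b,
   RInt (fun u => cz (f u)) a b).

(* Bounded or not; open, so that all derivatives below are two-sided. *)
Definition interval_open (I : R -> Prop) : Prop :=
  open I /\ forall x y z, I x -> I z -> x <= y <= z -> I y.

(* The curves need not have unit speed: differentiation with respect to the
   arc length of [g] is (1 / |g'|) d/dt, which is plain differentiation when
   [g] has unit speed. *)
Definition arc_derive (g f : R -> vec) (t : R) : vec :=
  scal (/ enorm (vderive g t)) (vderive f t).

Definition tangent (g : R -> vec) : R -> vec := arc_derive g g.

Definition curvature (g : R -> vec) (t : R) : R :=
  enorm (arc_derive g (tangent g) t).

Definition principal_normal (g : R -> vec) (t : R) : vec :=
  scal (/ curvature g t) (arc_derive g (tangent g) t).

Definition binormal (g : R -> vec) (t : R) : vec :=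
  cross (tangent g t) (principal_normal g t).

(* The B-component of dN/ds = - kappa T + tau B. *)
Definition torsion (g : R -> vec) (t : R) : R :=
  dot (arc_derive g (principal_normal g) t) (binormal g t).

Definition unit_darboux (g : R -> vec) (t : R) : vec :=
  scal (/ sqrt (torsion g t ^ 2 + curvature g t ^ 2))
    (plus (scal (torsion g t) (tangent g t))
          (scal (curvature g t) (binormal g t))).

Definition smooth_on (I : R -> Prop) (g : R -> vec) : Prop :=
  forall (n : nat) (t : R), I t ->
    ex_derive_n (fun u => cx (g u)) n t /\
    ex_derive_n (fun u => cy (g u)) n t /\
    ex_derive_n (fun u => cz (g u)) n t.

Definition regular_on (I : R -> Prop) (g : R -> vec) : Prop :=
  forall t, I t -> vderive g t <> zero.

Definition curved_on (I : R -> Prop) (g : R -> vec) : Prop :=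
  forall t, I t -> curvature g t <> 0.

Definition frenet_curve (I : R -> Prop) (g : R -> vec) : Prop :=
  smooth_on I g /\ regular_on I g /\ curved_on I g.

Definition unit_speed (I : R -> Prop) (g : R -> vec) : Prop :=
  forall t, I t -> enorm (vderive g t) = 1.

Definition slant_helix (I : R -> Prop) (g : R -> vec) : Prop :=
  frenet_curve I g /\
  exists (u : vec) (phi : R), enorm u = 1 /\
    forall t, I t -> dot (principal_normal g t) u = cos phi.

Definition circular_helix (I : R -> Prop) (g : R -> vec) : Prop :=
  frenet_curve I g /\
  exists k w : R, k <> 0 /\ w <> 0 /\
    forall t, I t -> curvature g t = k /\ torsion g t = w.

Definition normal_line (g : R -> vec) (t : R) (p : vec) : Prop :=
  exists r : R, p = plus (g t) (scal r (principal_normal g t)).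

(* Corresponding points of the two curves carry the same parameter, and are
   distinct. *)
Definition bertrand_mates (I : R -> Prop) (g b : R -> vec) : Prop :=
  forall t, I t ->
    b t <> g t /\ forall p, normal_line b t p <-> normal_line g t p.

Definition bertrand_curve (I : R -> Prop) (g : R -> vec) : Prop :=
  frenet_curve I g /\
  exists b : R -> vec, frenet_curve I b /\ bertrand_mates I g b.

Definition plane_curve (I : R -> Prop) (g : R -> vec) : Prop :=
  exists (n : vec) (d : R), n <> zero /\ forall t, I t -> dot n (g t) = d.

(* For a unit speed curve [alpha]. *)
Definition normal_arclength (alpha : R -> vec) (s : R) : R :=
  RInt (fun u => enorm (vderive (principal_normal alpha) u)) 0 s.

Definition image_on (I : R -> Prop) (f : R -> R) (y : R) : Prop :=
  exists x, I x /\ f x = y.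

(* [N] and [C] are here functions of the integration variable sigma. *)
Definition gamma_tilde (N C : R -> vec) (a theta : R) (c : vec) (sigma0 : R)
    (sigma : R) : vec :=
  plus (plus (scal a (vint N sigma0 sigma))
             (scal (a * (cos theta / sin theta)) (vint C sigma0 sigma)))
       c.

(* Main.v *)
(* On the unit sphere, parametrize the principal normal indicatrix by its arc
   length and let [N], [t = N'], [C = N x t] be its Sabban frame, so that
   [t' = - N + k C] and [C' = - k t]. The slant condition puts [N] on a circle
   with axis [u]: [t] is orthogonal to [N] and [u], hence [t = lam (u x N)] with
   [lam] constant, and [k = lam cos phi] is constant. Moreover [C] is the unit
   Darboux vector.

   The curve in question has derivative [p N + q C] with constant [p], [q]. Any
   such curve has speed [v = sqrt (p^2 + q^2)], curvature [|p - k q| / v^2],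
   principal normal [+/- t] and torsion [(q + k p) / v^2], and moving it by a
   constant multiple of [t] gives a curve of the same kind. *)

Require Import Defs.
From Stdlib Require Import Reals Lra Psatz Ranalysis5.
From Coquelicot Require Import Coquelicot.
Open Scope R_scope.

(** * Vector algebra *)

Lemma vec_ext (u v : vec) : cx u = cx v -> cy u = cy v -> cz u = cz v -> u = v.
Proof.
  destruct u as [[? ?] ?], v as [[? ?] ?]; unfold cx, cy, cz; simpl.
  now intros -> -> ->.
Qed.

Lemma cx_plus (u v : vec) : cx (plus u v) = cx u + cx v.
Proof. reflexivity. Qed.
Lemma cy_plus (u v : vec) : cy (plus u v) = cy u + cy v.
Proof. reflexivity. Qed.
Lemma cz_plus (u v : vec) : cz (plus u v) = cz u + cz v.
Proof. reflexivity. Qed.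
Lemma cx_scal (r : R) (v : vec) : cx (scal r v) = r * cx v.
Proof. reflexivity. Qed.
Lemma cy_scal (r : R) (v : vec) : cy (scal r v) = r * cy v.
Proof. reflexivity. Qed.
Lemma cz_scal (r : R) (v : vec) : cz (scal r v) = r * cz v.
Proof. reflexivity. Qed.
Lemma cx_cross (u v : vec) : cx (cross u v) = cy u * cz v - cz u * cy v.
Proof. reflexivity. Qed.
Lemma cy_cross (u v : vec) : cy (cross u v) = cz u * cx v - cx u * cz v.
Proof. reflexivity. Qed.
Lemma cz_cross (u v : vec) : cz (cross u v) = cx u * cy v - cy u * cx v.
Proof. reflexivity. Qed.
Lemma cx_zero : cx zero = 0.
Proof. reflexivity. Qed.
Lemma cy_zero : cy zero = 0.
Proof. reflexivity. Qed.
Lemma cz_zero : cz zero = 0.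
Proof. reflexivity. Qed.

#[local] Hint Rewrite cx_plus cy_plus cz_plus cx_scal cy_scal cz_scal
  cx_cross cy_cross cz_cross cx_zero cy_zero cz_zero : coord.

Ltac vec_ring :=
  intros; try apply vec_ext; unfold dot; autorewrite with coord; ring.

Lemma dot_comm (u v : vec) : dot u v = dot v u.
Proof. vec_ring. Qed.
Lemma dot_plus_l (u v w : vec) : dot (plus u v) w = dot u w + dot v w.
Proof. vec_ring. Qed.
Lemma dot_plus_r (u v w : vec) : dot u (plus v w) = dot u v + dot u w.
Proof. vec_ring. Qed.
Lemma dot_scal_l (r : R) (u v : vec) : dot (scal r u) v = r * dot u v.
Proof. vec_ring. Qed.
Lemma dot_scal_r (r : R) (u v : vec) : dot u (scal r v) = r * dot u v.
Proof. vec_ring. Qed.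
Lemma dot_zero_l (u : vec) : dot zero u = 0.
Proof. vec_ring. Qed.
Lemma dot_cross_l (u v : vec) : dot u (cross u v) = 0.
Proof. vec_ring. Qed.
Lemma dot_cross_r (u v : vec) : dot v (cross u v) = 0.
Proof. vec_ring. Qed.
Lemma dot_cross_cross (u v : vec) :
  dot (cross u v) (cross u v) = dot u u * dot v v - dot u v * dot u v.
Proof. vec_ring. Qed.
Lemma cross_plus_l (u v w : vec) : cross (plus u v) w = plus (cross u w) (cross v w).
Proof. vec_ring. Qed.
Lemma cross_scal_l (r : R) (u v : vec) : cross (scal r u) v = scal r (cross u v).
Proof. vec_ring. Qed.
Lemma cross_scal_r (r : R) (u v : vec) : cross u (scal r v) = scal r (cross u v).
Proof. vec_ring. Qed.
Lemma cross_cross_l (u v w : vec) :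
  cross (cross u v) w = plus (scal (dot u w) v) (scal (- dot v w) u).
Proof. vec_ring. Qed.
Lemma cross_cross_r (u v w : vec) :
  cross u (cross v w) = plus (scal (dot u w) v) (scal (- dot u v) w).
Proof. vec_ring. Qed.
Lemma scal_scal (r s : R) (v : vec) : scal r (scal s v) = scal (r * s) v.
Proof. vec_ring. Qed.

#[local] Hint Rewrite dot_plus_l dot_plus_r dot_scal_l dot_scal_r : dots.

Lemma dot_self_ge0 (v : vec) : 0 <= dot v v.
Proof. unfold dot; nra. Qed.

Lemma dot_self_eq0 (v : vec) : dot v v = 0 -> v = zero.
Proof. unfold dot; intros h; apply vec_ext; autorewrite with coord; nra. Qed.

Lemma enorm_sqr (v : vec) : enorm v * enorm v = dot v v.
Proof. apply sqrt_sqrt, dot_self_ge0. Qed.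

Lemma enorm_scal (r : R) (v : vec) : enorm (scal r v) = Rabs r * enorm v.
Proof.
  unfold enorm; autorewrite with dots.
  replace (r * (r * dot v v)) with (Rsqr r * dot v v) by (unfold Rsqr; ring).
  rewrite sqrt_mult_alt by apply Rle_0_sqr. now rewrite sqrt_Rsqr_abs.
Qed.

Lemma enorm_ge0 (v : vec) : 0 <= enorm v.
Proof. apply sqrt_pos. Qed.

(* A vector orthogonal to [u], [v] and [cross u v] vanishes, by Lagrange's
   identity applied to it and [cross u v]. *)
Lemma orthonormal_expansion (u v x : vec) :
  dot u u = 1 -> dot v v = 1 -> dot u v = 0 ->
  x = plus (plus (scal (dot x u) u) (scal (dot x v) v))
           (scal (dot x (cross u v)) (cross u v)).
Proof.
  intros huu hvv huv.
  set (b := cross u v).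
  assert (hbb : dot b b = 1) by (unfold b; rewrite dot_cross_cross; nra).
  assert (hub : dot u b = 0) by apply dot_cross_l.
  assert (hvb : dot v b = 0) by apply dot_cross_r.
  set (r := plus (plus (scal (dot x u) u) (scal (dot x v) v)) (scal (dot x b) b)).
  set (y := plus x (scal (-1) r)).
  assert (hyu : dot y u = 0).
  { unfold y, r; autorewrite with dots.
    rewrite huu, (dot_comm v u), (dot_comm b u), huv, hub; ring. }
  assert (hyv : dot y v = 0).
  { unfold y, r; autorewrite with dots.
    rewrite hvv, (dot_comm b v), huv, hvb; ring. }
  assert (hyb : dot y b = 0).
  { unfold y, r; autorewrite with dots. rewrite hbb, hub, hvb; ring. }
  assert (hcr : cross y b = zero).
  { unfold b; rewrite cross_cross_r, hyu, hyv; vec_ring. }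
  assert (hy : y = zero).
  { apply dot_self_eq0. generalize (dot_cross_cross y b).
    rewrite hcr, hbb, hyb, dot_zero_l; lra. }
  clearbody r. unfold y in hy.
  apply vec_ext;
    [apply (f_equal cx) in hy | apply (f_equal cy) in hy | apply (f_equal cz) in hy];
    autorewrite with coord in hy; lra.
Qed.

(** * Vector calculus *)

(** [Derive] is total and returns a value even where no derivative exists; the relational form also
    records differentiability. *)
Definition is_vderive (f : R -> vec) (t : R) (l : vec) : Prop :=
  is_derive (fun u => cx (f u)) t (cx l) /\
  is_derive (fun u => cy (f u)) t (cy l) /\
  is_derive (fun u => cz (f u)) t (cz l).

Lemma is_vderive_unique (f : R -> vec) (t : R) (l : vec) :
  is_vderive f t l -> vderive f t = l.
Proof.
  intros (hx & hy & hz); apply vec_ext; unfold vderive, cx, cy, cz; simpl;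
    now apply is_derive_unique.
Qed.

Lemma is_vderive_ext_loc (f g : R -> vec) (t : R) (l : vec) :
  locally t (fun u => f u = g u) -> is_vderive f t l -> is_vderive g t l.
Proof.
  intros h (hx & hy & hz); split; [|split].
  - apply (is_derive_ext_loc (V := R_NormedModule) (fun u => cx (f u)));
      [revert h; apply filter_imp; now intros u ->|easy].
  - apply (is_derive_ext_loc (V := R_NormedModule) (fun u => cy (f u)));
      [revert h; apply filter_imp; now intros u ->|easy].
  - apply (is_derive_ext_loc (V := R_NormedModule) (fun u => cz (f u)));
      [revert h; apply filter_imp; now intros u ->|easy].
Qed.

Lemma is_vderive_ext_on (I : R -> Prop) (f g : R -> vec) (t : R) (l : vec) :
  open I -> I t -> (forall u, I u -> f u = g u) ->
  is_vderive f t l -> is_vderive g t l.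
Proof.
  intros hI ht h. apply is_vderive_ext_loc.
  now apply (filter_imp I); [|apply hI].
Qed.

Lemma is_vderive_const (v : vec) (t : R) : is_vderive (fun _ => v) t zero.
Proof. split; [|split]; apply (is_derive_const (V := R_NormedModule)). Qed.

Lemma is_vderive_plus (f g : R -> vec) (t : R) (l m : vec) :
  is_vderive f t l -> is_vderive g t m ->
  is_vderive (fun u => plus (f u) (g u)) t (plus l m).
Proof.
  intros (? & ? & ?) (? & ? & ?); split; [|split];
    now apply (is_derive_plus (V := R_NormedModule)).
Qed.

Lemma is_vderive_scal (r : R) (f : R -> vec) (t : R) (l : vec) :
  is_vderive f t l -> is_vderive (fun u => scal r (f u)) t (scal r l).
Proof.
  intros (? & ? & ?); split; [|split].
  - now apply (is_derive_scal (fun u => cx (f u))).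
  - now apply (is_derive_scal (fun u => cy (f u))).
  - now apply (is_derive_scal (fun u => cz (f u))).
Qed.

Lemma is_derive_mult_R (f g : R -> R) (t l m : R) :
  is_derive f t l -> is_derive g t m ->
  is_derive (fun u => f u * g u) t (l * g t + f t * m).
Proof. intros; apply (is_derive_mult f g); auto using Rmult_comm. Qed.

Lemma is_derive_dot (f g : R -> vec) (t : R) (l m : vec) :
  is_vderive f t l -> is_vderive g t m ->
  is_derive (fun u => dot (f u) (g u)) t (dot l (g t) + dot (f t) m).
Proof.
  intros (fx & fy & fz) (gx & gy & gz). unfold dot.
  replace (_ + _) with
    ((cx l * cx (g t) + cx (f t) * cx m) + (cy l * cy (g t) + cy (f t) * cy m)
     + (cz l * cz (g t) + cz (f t) * cz m)) by ring.
  apply (is_derive_plus (V := R_NormedModule));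
    [apply (is_derive_plus (V := R_NormedModule))|];
    now apply is_derive_mult_R.
Qed.

Lemma is_vderive_cross (f g : R -> vec) (t : R) (l m : vec) :
  is_vderive f t l -> is_vderive g t m ->
  is_vderive (fun u => cross (f u) (g u)) t (plus (cross l (g t)) (cross (f t) m)).
Proof.
  intros (fx & fy & fz) (gx & gy & gz); split; [|split]; autorewrite with coord.
  - replace (_ + _) with
      ((cy l * cz (g t) + cy (f t) * cz m) - (cz l * cy (g t) + cz (f t) * cy m))
      by ring.
    apply (is_derive_minus (V := R_NormedModule)); now apply is_derive_mult_R.
  - replace (_ + _) with
      ((cz l * cx (g t) + cz (f t) * cx m) - (cx l * cz (g t) + cx (f t) * cz m))
      by ring.
    apply (is_derive_minus (V := R_NormedModule)); now apply is_derive_mult_R.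
  - replace (_ + _) with
      ((cx l * cy (g t) + cx (f t) * cy m) - (cy l * cx (g t) + cy (f t) * cx m))
      by ring.
    apply (is_derive_minus (V := R_NormedModule)); now apply is_derive_mult_R.
Qed.

Lemma is_vderive_comp (f : R -> vec) (g : R -> R) (t m : R) (l : vec) :
  is_vderive f (g t) l -> is_derive g t m ->
  is_vderive (fun u => f (g u)) t (scal m l).
Proof.
  intros (? & ? & ?) hg; split; [|split].
  - now apply (is_derive_comp (fun u => cx (f u)) g).
  - now apply (is_derive_comp (fun u => cy (f u)) g).
  - now apply (is_derive_comp (fun u => cz (f u)) g).
Qed.

(** * Real functions on an interval: constancy and higher derivatives *)

Lemma derive_zero_const (I : R -> Prop) (f : R -> R) (x y : R) :
  interval_open I -> (forall t, I t -> is_derive f t 0) -> I x -> I y -> f x = f y.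
Proof.
  intros [_ hI] hf.
  assert (aux : forall x y, I x -> I y -> x < y -> f x = f y).
  { intros x' y' hx hy hlt. apply (eq_is_derive f); [|easy].
    intros t ht. apply hf. now apply (hI x' t y'). }
  intros hx hy.
  destruct (Rtotal_order x y) as [h|[->|h]]; [now apply aux|easy|].
  symmetry; now apply aux.
Qed.

(** The only possible values are [1] and [-1], and passing from one to the other would force a zero
    in between. *)
Lemma unit_square_const (I : R -> Prop) (f : R -> R) (x y : R) :
  interval_open I -> (forall t, I t -> continuity_pt f t) ->
  (forall t, I t -> f t * f t = 1) -> I x -> I y -> f x = f y.
Proof.
  intros [_ hI] hc h1.
  assert (aux : forall x y, I x -> I y -> x < y -> f x = f y).
  { intros x' y' hx hy hlt.
    assert (c : forall t, x' <= t <= y' -> continuity_pt f t).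
    { intros t ht; apply hc, (hI x' t y'); easy. }
    generalize (h1 x' hx) (h1 y' hy); intros ex ey.
    destruct (Rlt_dec (f x') 0) as [n|p]; destruct (Rlt_dec (f y') 0) as [n'|p'];
      try nra.
    - destruct (IVT_interv f x' y') as [z [hz fz]]; try nra; auto.
      generalize (h1 z (hI x' z y' hx hy hz)); nra.
    (* [IVT_interv] goes from a negative to a positive value, so the other sign change is treated
       through [- f]. *)
    - destruct (IVT_interv (fun t => - f t) x' y') as [z [hz fz]];
        try nra; auto.
      + intros t ht; now apply continuity_pt_opp, c.
      + generalize (h1 z (hI x' z y' hx hy hz)); nra. }
  intros hx hy.
  destruct (Rtotal_order x y) as [h|[->|h]]; [now apply aux|easy|].
  symmetry; now apply aux.
Qed.

(** [Derive_n] adds derivatives on the outside, whereas what is known here is the innermost one,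
    [h1]. The two orders are reconciled on a neighbourhood of [t]. *)
Lemma ex_derive_n_step (J : R -> Prop) (h h1 : R -> R) (m : nat) (t : R) :
  open J -> J t -> (forall u, J u -> is_derive h u (h1 u)) ->
  ex_derive_n h1 m t -> ex_derive_n h (S m) t.
Proof.
  intros hJ ht hd h1m. destruct m as [|m]; simpl.
  { exists (h1 t); now apply hd. }
  simpl in h1m.
  apply ex_derive_ext_loc with (2 := h1m).
  assert (hl : locally t J) by now apply hJ.
  (* Comparing higher derivatives at a nearby [u] needs [h1] to be the derivative of [h] all around
     [u], not only at [u]. *)
  apply locally_locally in hl.
  revert hl; apply filter_imp; intros u hu.
  change (Derive_n h1 m u = Derive_n h (S m) u).
  replace (S m) with (m + 1)%nat by lia.
  rewrite <- Derive_n_comp.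
  apply Derive_n_ext_loc. revert hu; apply filter_imp; intros v hv.
  symmetry; now apply is_derive_unique, hd.
Qed.

(** * Increasing functions, their images and their inverses *)

Lemma increasing_on (I : R -> Prop) (f f' : R -> R) (x y : R) :
  interval_open I -> (forall t, I t -> is_derive f t (f' t)) ->
  (forall t, I t -> 0 < f' t) -> I x -> I y -> x < y -> f x < f y.
Proof.
  intros [_ hI] hf hpos hx hy hxy.
  assert (hin : forall t, x <= t <= y -> I t) by (intros t; now apply hI).
  destruct (MVT_gen f x y f') as [c [hc e]];
    rewrite ?Rmin_left, ?Rmax_right in * by lra.
  - intros t ht; apply hf, hin; lra.
  - intros t ht. apply derivable_continuous_pt; exists (f' t).
    apply is_derive_Reals, hf, hin, ht.
  - generalize (hpos c (hin c hc)); nra.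
Qed.

Lemma image_interval (I : R -> Prop) (f f' : R -> R) (a b y : R) :
  interval_open I -> (forall t, I t -> is_derive f t (f' t)) ->
  (forall t, I t -> 0 < f' t) -> I a -> I b -> f a <= y <= f b -> image_on I f y.
Proof.
  intros hI hf hpos ha hb hy.
  destruct (Rtotal_order a b) as [hab|[e|hab]].
  2:{ subst b; exists a; split; [easy|lra]. }
  2:{ generalize (increasing_on I f f' b a hI hf hpos hb ha hab); lra. }
  destruct (f_interv_is_interv f a b y) as [x [hx e]]; trivial.
  - intros t ht. apply derivable_continuous_pt; exists (f' t).
    apply is_derive_Reals, hf. now apply (proj2 hI a t b).
  - exists x; split; trivial. now apply (proj2 hI a x b).
Qed.

Lemma open_nbhd_segment (I : R -> Prop) (x : R) :
  open I -> I x -> exists lb ub, lb < x < ub /\ forall t, lb <= t <= ub -> I t.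
Proof.
  intros hI hx; destruct (hI x hx) as [d hd].
  generalize (cond_pos d); intros hp.
  exists (x - d / 2), (x + d / 2); split; [lra|].
  intros t ht; apply hd. change (Rabs (t - x) < d); apply Rabs_def1; lra.
Qed.

(** Strict monotonicity places [f x] strictly between the values at two points bracketing [x], and
    the intermediate value theorem fills that gap with values of [f]. *)
Lemma image_interval_open (I : R -> Prop) (f f' : R -> R) :
  interval_open I -> (forall t, I t -> is_derive f t (f' t)) ->
  (forall t, I t -> 0 < f' t) -> interval_open (image_on I f).
Proof.
  intros hI hf hpos; split.
  - intros y [x [hx <-]].
    destruct (open_nbhd_segment I x (proj1 hI) hx) as (lb & ub & hlu & hin).
    assert (hl : I lb) by (apply hin; lra). assert (hu : I ub) by (apply hin; lra).
    apply (filter_imp (fun u => f lb < u /\ u < f ub)).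
    + intros u hu'; apply (image_interval I f f' lb ub); trivial; lra.
    + apply filter_and; [apply open_gt|apply open_lt];
        now apply (increasing_on I f f').
  - intros u y w [a [ha <-]] [b [hb <-]] hy.
    now apply (image_interval I f f' a b).
Qed.

(** [g] is only known to undo [f] on [I]. The intermediate value theorem makes it a two-sided
    inverse on a segment around [x], where the inverse function theorem gives derivability; the
    chain rule then fixes the value. *)
Lemma is_derive_left_inverse (I : R -> Prop) (f f' g : R -> R) (x : R) :
  interval_open I -> (forall t, I t -> is_derive f t (f' t)) ->
  (forall t, I t -> 0 < f' t) -> (forall t, I t -> g (f t) = t) ->
  I x -> is_derive g (f x) (/ f' x).
Proof.
  intros hI hf hpos hg hx.
  destruct (open_nbhd_segment I x (proj1 hI) hx) as (lb & ub & hlu & hin).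
  assert (hl : I lb) by (apply hin; lra). assert (hu : I ub) by (apply hin; lra).
  assert (hmono : forall s t, I s -> I t -> s < t -> f s < f t)
    by (intros; now apply (increasing_on I f f')).
  assert (hsurj : forall y, f lb <= y <= f ub ->
    exists t, lb <= t <= ub /\ f t = y).
  { intros y hy; destruct (image_interval I f f' lb ub y) as [t [ht e]]; trivial.
    exists t; split; trivial; split.
    - destruct (Rle_lt_dec lb t) as [|h]; trivial.
      generalize (hmono t lb ht hl h); lra.
    - destruct (Rle_lt_dec t ub) as [|h]; trivial.
      generalize (hmono ub t hu ht h); lra. }
  assert (lb_lt_ub : lb < ub) by lra.
  assert (x_encad : f lb < f x < f ub) by (split; apply hmono; trivial; lra).
  assert (feqg : forall y, f lb <= y -> y <= f ub -> comp f g y = id y).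
  { intros y h1 h2; destruct (hsurj y (conj h1 h2)) as (t & ht & <-).
    unfold comp, id; now rewrite hg by now apply hin. }
  assert (gwf : forall y, f lb <= y -> y <= f ub -> lb <= g y <= ub).
  { intros y h1 h2; destruct (hsurj y (conj h1 h2)) as (t & ht & <-).
    now rewrite hg by now apply hin. }
  assert (fincr : forall s t, lb <= s -> s < t -> t <= ub -> f s < f t).
  { intros s t h1 h2 h3; apply hmono; trivial; apply hin; lra. }
  assert (fder : forall t, lb <= t <= ub -> derivable_pt f t).
  { intros t ht; exists (f' t). now apply is_derive_Reals, hf, hin. }
  assert (hgx : ex_derive g (f x)).
  { apply ex_derive_Reals_1.
    apply (derivable_pt_recip_interv f g lb ub (f x) lb_lt_ub x_encad feqg gwf
             fincr fder).
    rewrite Derive_Reals, hg by trivial.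
    rewrite (is_derive_unique _ _ _ (hf x hx)). generalize (hpos x hx); lra. }
  destruct hgx as [d hd].
  replace (/ f' x) with d; [exact hd|].
  (* The derivative of [g (f t) = t] is computed in two ways, which forces [f' x * d = 1]. *)
  assert (h1 : is_derive (fun t => g (f t)) x (f' x * d)).
  { exact (is_derive_comp g f x d (f' x) hd (hf x hx)). }
  assert (h2 : is_derive (fun t => g (f t)) x 1).
  { apply (is_derive_ext_loc (V := R_NormedModule) (fun t => t)).
    - apply (filter_imp I); [|now apply hI]. intros t ht; now rewrite hg.
    - apply (is_derive_id (K := R_AbsRing)). }
  apply is_derive_unique in h1; apply is_derive_unique in h2.
  generalize (hpos x hx); intros hp.
  apply (Rmult_eq_reg_l (f' x)); [|lra]. rewrite Rinv_r; lra.
Qed.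

(** * Integrals, norms and products of vector functions *)

Lemma is_derive_integral (I : R -> Prop) (f : R -> R) (a x : R) :
  interval_open I -> (forall t, I t -> continuous f t) -> I a -> I x ->
  is_derive (fun y => RInt f a y) x (f x).
Proof.
  intros [hI hc] hf ha hx.
  apply (is_derive_RInt (V := R_NormedModule) f _ a); [|now apply hf].
  apply (filter_imp I); [|now apply hI].
  intros y hy; apply (RInt_correct (V := R_CompleteNormedModule)).
  apply (ex_RInt_continuous (V := R_CompleteNormedModule)); intros z hz; apply hf.
  revert hz; unfold Rmin, Rmax; destruct (Rle_dec a y); intros hz;
    [now apply (hc a z y)|now apply (hc y z a)].
Qed.

Lemma is_vderive_continuous (f : R -> vec) (t : R) (l : vec) :
  is_vderive f t l ->
  continuous (fun u => cx (f u)) t /\ continuous (fun u => cy (f u)) t /\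
  continuous (fun u => cz (f u)) t.
Proof.
  intros (hx & hy & hz); split; [|split];
    apply (ex_derive_continuous (V := R_NormedModule)); eexists; eassumption.
Qed.

Lemma is_vderive_vint (I : R -> Prop) (f : R -> vec) (a x : R) :
  interval_open I -> (forall t, I t -> exists l, is_vderive f t l) -> I a -> I x ->
  is_vderive (vint f a) x (f x).
Proof.
  intros hI hf ha hx.
  assert (hc : forall t, I t ->
    continuous (fun u => cx (f u)) t /\ continuous (fun u => cy (f u)) t /\
    continuous (fun u => cz (f u)) t).
  { intros t ht; destruct (hf t ht) as [l hl]; now apply is_vderive_continuous in hl. }
  split; [|split].
  - apply (is_derive_integral I (fun u => cx (f u)) a x hI); trivial; apply hc.
  - apply (is_derive_integral I (fun u => cy (f u)) a x hI); trivial; apply hc.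
  - apply (is_derive_integral I (fun u => cz (f u)) a x hI); trivial; apply hc.
Qed.

Lemma is_derive_enorm (f : R -> vec) (t : R) (l : vec) :
  is_vderive f t l -> 0 < dot (f t) (f t) ->
  is_derive (fun u => enorm (f u)) t (dot (f t) l / enorm (f t)).
Proof.
  intros hf hp; unfold enorm.
  generalize (is_derive_sqrt _ _ _ (is_derive_dot f f t l l hf hf) hp).
  generalize (sqrt_lt_R0 _ hp); intros hs.
  match goal with |- is_derive _ _ ?l -> is_derive _ _ ?m =>
    replace l with m; [easy|] end.
  rewrite (dot_comm l); field; lra.
Qed.

Lemma is_vderive_scal_fun (r : R -> R) (f : R -> vec) (t r' : R) (l : vec) :
  is_derive r t r' -> is_vderive f t l ->
  is_vderive (fun u => scal (r u) (f u)) t (plus (scal r' (f t)) (scal (r t) l)).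
Proof.
  intros hr (? & ? & ?); split; [|split].
  - now apply (is_derive_mult_R r (fun u => cx (f u))).
  - now apply (is_derive_mult_R r (fun u => cy (f u))).
  - now apply (is_derive_mult_R r (fun u => cz (f u))).
Qed.

(** Source of the orthogonality relations for the frames: each comes from differentiating a constant
    inner product. *)
Lemma dot_const_derive (I : R -> Prop) (f g : R -> vec) (c t : R) (l m : vec) :
  open I -> I t -> (forall u, I u -> dot (f u) (g u) = c) ->
  is_vderive f t l -> is_vderive g t m -> dot l (g t) + dot (f t) m = 0.
Proof.
  intros hI ht hc hf hg.
  rewrite <- (is_derive_unique _ _ _ (is_derive_dot f g t l m hf hg)).
  apply is_derive_unique.
  apply (is_derive_ext_loc (V := R_NormedModule) (fun _ => c)).
  - apply (filter_imp I); [|now apply hI]. intros u hu; now rewrite hc.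
  - apply (is_derive_const (V := R_NormedModule)).
Qed.

Definition vderive_n (n : nat) (f : R -> vec) (t : R) : vec :=
  (Derive_n (fun u => cx (f u)) n t,
   Derive_n (fun u => cy (f u)) n t,
   Derive_n (fun u => cz (f u)) n t).

Lemma is_vderive_vderive_n (I : R -> Prop) (f : R -> vec) (n : nat) (t : R) :
  smooth_on I f -> I t -> is_vderive (vderive_n n f) t (vderive_n (S n) f t).
Proof.
  intros hf ht; destruct (hf (S n) t ht) as (hx & hy & hz).
  split; [|split]; now apply Derive_correct.
Qed.

(** * Sabban frames with constant geodesic curvature *)

(* [k] is the geodesic curvature; the frame is [N], [t], [cross N t]. *)
Definition sabban_frame (J : R -> Prop) (N t : R -> vec) (k : R) : Prop :=
  forall s, J s ->
    dot (N s) (N s) = 1 /\ dot (t s) (t s) = 1 /\ dot (N s) (t s) = 0 /\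
    is_vderive N s (t s) /\
    is_vderive t s (plus (scal (-1) (N s)) (scal k (cross (N s) (t s)))).

Section Sabban.

Variables (J : R -> Prop) (N t : R -> vec) (k : R).
Hypothesis hJ : open J.
Hypothesis frame : sabban_frame J N t k.

Let C (s : R) : vec := cross (N s) (t s).

Lemma sabban_dots (s : R) : J s ->
  dot (N s) (N s) = 1 /\ dot (t s) (t s) = 1 /\ dot (C s) (C s) = 1 /\
  dot (N s) (t s) = 0 /\ dot (N s) (C s) = 0 /\ dot (t s) (C s) = 0.
Proof.
  intros hs; destruct (frame s hs) as (h1 & h2 & h3 & _).
  repeat split; trivial.
  - unfold C; rewrite dot_cross_cross, h1, h2, h3; ring.
  - apply dot_cross_l.
  - apply dot_cross_r.
Qed.

Lemma sabban_cross_C_t (s : R) : J s -> cross (C s) (t s) = scal (-1) (N s).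
Proof.
  intros hs; destruct (frame s hs) as (h1 & h2 & h3 & _).
  unfold C; rewrite cross_cross_l, h2, h3; vec_ring.
Qed.

(** In the product rule [t x t] and [N x N] vanish, and only [k N x (N x t) = - k t] survives. *)
Lemma is_vderive_sabban_C (s : R) : J s -> is_vderive C s (scal (- k) (t s)).
Proof.
  intros hs; destruct (frame s hs) as (h1 & h2 & h3 & hN & ht).
  generalize (is_vderive_cross _ _ _ _ _ hN ht). unfold C.
  match goal with |- is_vderive _ _ ?l -> is_vderive _ _ ?m =>
    replace l with m; [easy|] end.
  replace (cross (N s) (plus _ _))
    with (scal k (cross (N s) (cross (N s) (t s)))) by vec_ring.
  rewrite cross_cross_r, h1, h3. vec_ring.
Qed.

(** Since [k] is constant, differentiation acts linearly on constant coefficients. Smoothness, the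
    derivative of the tangent and the constancy of a binormal direction are all instances. *)
Lemma is_vderive_sabban_comb (x y z s : R) : J s ->
  is_vderive (fun u => plus (plus (scal x (N u)) (scal y (t u))) (scal z (C u))) s
    (plus (plus (scal (- y) (N s)) (scal (x - k * z) (t s))) (scal (k * y) (C s))).
Proof.
  intros hs; destruct (frame s hs) as (_ & _ & _ & hN & ht).
  generalize (is_vderive_plus _ _ _ _ _
    (is_vderive_plus _ _ _ _ _ (is_vderive_scal x _ _ _ hN)
                               (is_vderive_scal y _ _ _ ht))
    (is_vderive_scal z _ _ _ (is_vderive_sabban_C s hs))).
  match goal with |- is_vderive _ _ ?l -> is_vderive _ _ ?m =>
    replace l with m; [easy|unfold C; vec_ring] end.
Qed.

(* The span of the frame is stable under differentiation. *)
Lemma sabban_comb_smooth (n : nat) : forall x y z s, J s ->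
  let f u := plus (plus (scal x (N u)) (scal y (t u))) (scal z (C u)) in
  ex_derive_n (fun u => cx (f u)) n s /\
  ex_derive_n (fun u => cy (f u)) n s /\
  ex_derive_n (fun u => cz (f u)) n s.
Proof.
  induction n as [|n IH]; [easy|]; intros x y z s hs f.
  destruct (IH (- y) (x - k * z) (k * y) s hs) as (hx & hy & hz).
  split; [|split].
  - apply (ex_derive_n_step J _ _ n s hJ hs) with (2 := hx).
    intros u hu; apply (is_vderive_sabban_comb x y z u hu).
  - apply (ex_derive_n_step J _ _ n s hJ hs) with (2 := hy).
    intros u hu; apply (is_vderive_sabban_comb x y z u hu).
  - apply (ex_derive_n_step J _ _ n s hJ hs) with (2 := hz).
    intros u hu; apply (is_vderive_sabban_comb x y z u hu).
Qed.

(** * Curves with velocity [p N + q C] *)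

Variables (g : R -> vec) (p q : R).
Hypothesis hg : forall s, J s -> is_vderive g s (plus (scal p (N s)) (scal q (C s))).

Lemma sabban_curve_smooth : smooth_on J g.
Proof.
  intros [|n] s hs; [easy|].
  destruct (sabban_comb_smooth n p 0 q s hs) as (hx & hy & hz).
  (* A zero [t]-component puts the velocity in the form whose smoothness is already known. *)
  assert (hg0 : forall u, J u -> is_vderive g u
    (plus (plus (scal p (N u)) (scal 0 (t u))) (scal q (C u)))).
  { intros u hu; generalize (hg u hu).
    match goal with |- is_vderive _ _ ?l -> is_vderive _ _ ?m =>
      replace l with m; [easy|vec_ring] end. }
  split; [|split].
  - apply (ex_derive_n_step J _ _ n s hJ hs) with (2 := hx); apply hg0.
  - apply (ex_derive_n_step J _ _ n s hJ hs) with (2 := hy); apply hg0.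
  - apply (ex_derive_n_step J _ _ n s hJ hs) with (2 := hz); apply hg0.
Qed.

Let v := sqrt (p * p + q * q).

Lemma sabban_curve_speed (s : R) : J s -> enorm (vderive g s) = v.
Proof.
  intros hs; rewrite (is_vderive_unique _ _ _ (hg s hs)); unfold enorm, v.
  destruct (sabban_dots s hs) as (h1 & h2 & h3 & h4 & h5 & h6).
  f_equal; autorewrite with dots; rewrite (dot_comm (C s)), h1, h3, h5; ring.
Qed.

Lemma sabban_curve_tangent (s : R) : J s ->
  tangent g s = plus (scal (p / v) (N s)) (scal (q / v) (C s)).
Proof.
  intros hs; unfold tangent, arc_derive.
  rewrite (sabban_curve_speed s hs), (is_vderive_unique _ _ _ (hg s hs)).
  unfold Rdiv; vec_ring.
Qed.

(** The coefficients [(p / v, 0, q / v)] are sent to a pure multiple of [t]; the second factor [/ v]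
    converts to arc length. *)
Lemma sabban_curve_tangent_derive (s : R) : J s ->
  arc_derive g (tangent g) s = scal (/ v * / v * (p - k * q)) (t s).
Proof.
  intros hs; unfold arc_derive; rewrite (sabban_curve_speed s hs).
  rewrite (is_vderive_unique (tangent g) s
             (scal (/ v * (p - k * q)) (t s))); [vec_ring|].
  apply (is_vderive_ext_on J
    (fun u => plus (plus (scal (p / v) (N u)) (scal 0 (t u))) (scal (q / v) (C u))));
    trivial.
  - intros u hu; rewrite (sabban_curve_tangent u hu); vec_ring.
  - generalize (is_vderive_sabban_comb (p / v) 0 (q / v) s hs).
    match goal with |- is_vderive _ _ ?l -> is_vderive _ _ ?m =>
      replace l with m; [easy|unfold Rdiv; vec_ring] end.
Qed.

Lemma sabban_curve_curvature (s : R) : J s ->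
  curvature g s = / v * / v * Rabs (p - k * q).
Proof.
  intros hs; unfold curvature.
  rewrite (sabban_curve_tangent_derive s hs), enorm_scal.
  unfold enorm; destruct (sabban_dots s hs) as (_ & -> & _).
  rewrite sqrt_1, Rmult_1_r, Rabs_mult.
  now rewrite (Rabs_pos_eq (/ v * / v)) by apply Rle_0_sqr.
Qed.

(** The curvature formula holds before [v] is known to be non-zero, as both sides carry the same
    [/ v]. It can therefore be used to obtain [p - k * q <> 0], from which [0 < v] follows. *)
Lemma sabban_curve_curved (s : R) : J s -> curvature g s <> 0 -> p - k * q <> 0.
Proof.
  intros hs h e; apply h; rewrite (sabban_curve_curvature s hs), e, Rabs_R0; ring.
Qed.

Hypothesis hpq : p - k * q <> 0.

Lemma sabban_curve_sqr_pos : 0 < p * p + q * q.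
Proof.
  destruct (Req_dec q 0) as [hq|]; [|nra].
  assert (p <> 0) by (intros hp; apply hpq; rewrite hp, hq; ring). nra.
Qed.

Lemma sabban_curve_speed_pos : 0 < v.
Proof. apply sqrt_lt_R0, sabban_curve_sqr_pos. Qed.

(** The sign of [p - k * q]: the curvature absorbs the absolute value, and the sign is left to the
    principal normal. *)
Let e := (p - k * q) / Rabs (p - k * q).

Lemma sabban_curve_normal (s : R) : J s -> principal_normal g s = scal e (t s).
Proof.
  intros hs; unfold principal_normal.
  rewrite (sabban_curve_curvature s hs), (sabban_curve_tangent_derive s hs), scal_scal.
  f_equal; unfold e; generalize sabban_curve_speed_pos, (Rabs_no_R0 _ hpq).
  intros; field; lra.
Qed.

Lemma sabban_curve_sign_sqr : e * e = 1.
Proof.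
  unfold e; generalize (Rabs_no_R0 _ hpq); intros h.
  replace (_ * _) with
    (Rsqr (p - k * q) / Rsqr (Rabs (p - k * q))) by (unfold Rsqr; field; lra).
  rewrite <- Rsqr_abs; field. unfold Rsqr; nra.
Qed.

(** The normal is [e t] and the binormal [e (p C - q N) / v]; the sign enters twice and cancels as
    [e * e = 1]. *)
Lemma sabban_curve_torsion (s : R) : J s ->
  torsion g s = / v * / v * (q + k * p).
Proof.
  intros hs; unfold torsion, binormal, arc_derive.
  destruct (frame s hs) as (_ & _ & _ & _ & ht).
  rewrite (sabban_curve_speed s hs), (sabban_curve_tangent s hs),
    (sabban_curve_normal s hs).
  rewrite (is_vderive_unique (principal_normal g) s
    (scal e (plus (scal (-1) (N s)) (scal k (C s))))).
  2:{ apply (is_vderive_ext_on J (fun u => scal e (t u))); trivial.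
      - intros u hu; symmetry; now apply sabban_curve_normal.
      - now apply is_vderive_scal. }
  rewrite cross_scal_r, cross_plus_l, !cross_scal_l, (sabban_cross_C_t s hs).
  fold (C s).
  destruct (sabban_dots s hs) as (h1 & h2 & h3 & h4 & h5 & h6).
  autorewrite with dots; rewrite (dot_comm (C s) (N s)), h1, h3, h5.
  transitivity (e * e * (/ v * / v * (q + k * p))); [unfold Rdiv; ring|].
  rewrite sabban_curve_sign_sqr; ring.
Qed.

Lemma sabban_curve_frenet : frenet_curve J g.
Proof.
  generalize sabban_curve_speed_pos; intros hv.
  split; [apply sabban_curve_smooth|split]; intros s hs h.
  - generalize (sabban_curve_speed s hs).
    rewrite h; unfold enorm; rewrite dot_zero_l, sqrt_0; lra.
  - revert h; rewrite (sabban_curve_curvature s hs).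
    apply Rmult_integral_contrapositive_currified; [|now apply Rabs_no_R0].
    apply Rmult_integral_contrapositive_currified; apply Rinv_neq_0_compat; lra.
Qed.

End Sabban.

(** * Bertrand mates and helices from a Sabban frame *)

(* The mate is the curve [g - n], [n] the principal normal of [g]: it lies at
   distance 1 on the side away from the centre of curvature, so that its own
   curvature cannot vanish. *)
Lemma sabban_curve_bertrand (J : R -> Prop) (N t g : R -> vec) (k p q : R) :
  open J -> sabban_frame J N t k ->
  (forall s, J s ->
     is_vderive g s (plus (scal p (N s)) (scal q (cross (N s) (t s))))) ->
  p - k * q <> 0 -> bertrand_curve J g.
Proof.
  intros hJ frame hg hpq.
  split; [eapply sabban_curve_frenet; eauto|].
  set (e := (p - k * q) / Rabs (p - k * q)).
  generalize (sabban_curve_sign_sqr k p q hpq); fold e; intros hee.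
  generalize (Rabs_pos_lt _ hpq); intros habs.
  assert (he : p - k * q = e * Rabs (p - k * q)) by (unfold e; field; lra).
  set (b := fun s => plus (g s) (scal (- e) (t s))).
  (* These are the coefficients of [b'], obtained by subtracting [e t' = e (- N + k C)] from
     [p N + q C]. *)
  set (p' := p + e). set (q' := q - e * k).
  assert (hb : forall s, J s ->
     is_vderive b s (plus (scal p' (N s)) (scal q' (cross (N s) (t s))))).
  { intros s hs; destruct (frame s hs) as (_ & _ & _ & _ & ht).
    generalize (is_vderive_plus _ _ _ _ _ (hg s hs)
                  (is_vderive_scal (- e) _ _ _ ht)).
    match goal with |- is_vderive _ _ ?l -> is_vderive _ _ ?m =>
      replace l with m; [easy|unfold p', q'; vec_ring] end. }
  (* The discriminating quantity of the mate is [e] times a positive number, so the mate is curved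
     and has the same principal normal [e t]. *)
  assert (hd : p' - k * q' = e * (Rabs (p - k * q) + 1 + k * k)).
  { unfold p', q'; nra. }
  assert (hpos : 0 < Rabs (p - k * q) + 1 + k * k) by nra.
  assert (hpq' : p' - k * q' <> 0).
  { rewrite hd; apply Rmult_integral_contrapositive_currified; [|lra].
    intros h; rewrite h in hee; lra. }
  assert (he' : (p' - k * q') / Rabs (p' - k * q') = e).
  { rewrite hd, Rabs_mult, (Rabs_pos_eq (_ + _)) by lra.
    assert (he1 : Rabs e = 1).
    { unfold e; rewrite Rabs_div, Rabs_Rabsolu by lra; field; lra. }
    rewrite he1; field; lra. }
  exists b; split; [eapply sabban_curve_frenet; eauto|].
  intros s hs.
  destruct (frame s hs) as (_ & htt & _).
  split.
  - intros h. assert (h0 : scal (- e) (t s) = zero :> vec).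
    { transitivity (plus (b s) (scal (-1) (g s))); [unfold b; vec_ring|].
      rewrite h; vec_ring. }
    apply (f_equal (fun x => dot x x)) in h0.
    rewrite dot_zero_l in h0; autorewrite with dots in h0; nra.
  - intros x; unfold normal_line.
    rewrite (sabban_curve_normal J N t k hJ frame g p q hg hpq s hs),
      (sabban_curve_normal J N t k hJ frame b p' q' hb hpq' s hs), he'; fold e.
    unfold b; split; intros [r ->].
    (* The base points differ by one unit normal, so the parameter along the common line shifts by
       1. *)
    + exists (r - 1); vec_ring.
    + exists (r + 1); vec_ring.
Qed.

(** Curvature and torsion are given by constant formulas. Only the factor [q + k * p] of the torsion
    could vanish, and then the curve would lie in a plane orthogonal to its binormal. *)
Lemma sabban_curve_helix (J : R -> Prop) (N t g : R -> vec) (k p q : R) :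
  interval_open J -> sabban_frame J N t k ->
  (forall s, J s ->
     is_vderive g s (plus (scal p (N s)) (scal q (cross (N s) (t s))))) ->
  p - k * q <> 0 -> (exists s, J s) -> ~ plane_curve J g -> circular_helix J g.
Proof.
  intros [hJ hJc] frame hg hpq [s0 hs0] hplane.
  split; [eapply sabban_curve_frenet; eauto|].
  generalize (sabban_curve_speed_pos k p q hpq); intros hv.
  exists (/ sqrt (p * p + q * q) * / sqrt (p * p + q * q) * Rabs (p - k * q)),
    (/ sqrt (p * p + q * q) * / sqrt (p * p + q * q) * (q + k * p)).
  assert (hii : / sqrt (p * p + q * q) * / sqrt (p * p + q * q) <> 0).
  { apply Rmult_integral_contrapositive_currified; apply Rinv_neq_0_compat; lra. }
  split; [|split].
  - apply Rmult_integral_contrapositive_currified; [easy|now apply Rabs_no_R0].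
  - apply Rmult_integral_contrapositive_currified; [easy|].
    intros h0; apply hplane.
    (* With torsion zero, the binormal direction [p C - q N] is constant. *)
    set (C := fun s => cross (N s) (t s)).
    set (m := fun s => plus (plus (scal (- q) (N s)) (scal 0 (t s))) (scal p (C s))).
    assert (hm : forall s, J s -> is_vderive m s zero).
    { intros s hs.
      generalize (is_vderive_sabban_comb J N t k frame (- q) 0 p s hs).
      match goal with |- is_vderive _ _ ?l -> is_vderive _ _ ?z =>
        replace l with z; [easy|] end.
      (* The derivative of [m] has only a [t]-component, whose coefficient is minus the vanishing
         torsion factor. *)
      replace (- q - k * p) with 0 by lra. vec_ring. }
    assert (hmc : forall s, J s -> m s = m s0).
    { intros s hs; apply vec_ext;
        [apply (derive_zero_const J (fun u => cx (m u)))
        |apply (derive_zero_const J (fun u => cy (m u)))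
        |apply (derive_zero_const J (fun u => cz (m u)))];
        trivial; try easy; intros u hu; apply (hm u hu). }
    exists (m s0), (dot (m s0) (g s0)); split.
    (* The squared length of [m s0] is [p^2 + q^2], which is positive. *)
    + intros hz.
      destruct (sabban_dots J N t k frame s0 hs0) as (h1 & h2 & h3 & h4 & h5 & h6).
      apply (f_equal (fun x => dot x x)) in hz.
      rewrite dot_zero_l in hz; unfold m, C in hz; autorewrite with dots in hz.
      rewrite (dot_comm (t s0) (N s0)), (dot_comm (cross _ _)),
        (dot_comm (cross _ _) (t s0)), h1, h2, h3, h4, h5, h6 in hz.
      generalize (sabban_curve_sqr_pos k p q hpq); lra.
    + intros s hs.
      apply (derive_zero_const J (fun u => dot (m s0) (g u))); trivial; [easy|].
      intros u hu.
      generalize (is_derive_dot _ _ _ _ _ (is_vderive_const (m s0) u) (hg u hu)).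
      match goal with |- is_derive _ _ ?l -> is_derive _ _ ?z =>
        replace l with z; [easy|] end.
      destruct (sabban_dots J N t k frame u hu) as (h1 & h2 & h3 & h4 & h5 & h6).
      (* Once [m s0] is moved to [m u], the pairing of [p C - q N] with [p N + q C] is zero. *)
      rewrite <- (hmc u hu), dot_zero_l; unfold m, C; autorewrite with dots.
      rewrite (dot_comm (t u) (N u)), (dot_comm (cross _ _) (N u)), h1, h3, h4, h5, h6.
      ring.
  - intros s hs; split.
    + now apply (sabban_curve_curvature J N t k hJ frame g p q hg).
    + now apply (sabban_curve_torsion J N t k hJ frame g p q hg).
Qed.

(** * The principal normal indicatrix *)

Section Frenet.

Variables (I : R -> Prop) (alpha : R -> vec).
Hypotheses (hI : open I) (hunit : unit_speed I alpha) (hfrenet : frenet_curve I alpha).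

Let A (n : nat) : R -> vec := vderive_n n alpha.

Lemma is_vderive_A (n : nat) (s : R) : I s -> is_vderive (A n) s (A (S n) s).
Proof. apply is_vderive_vderive_n, hfrenet. Qed.

Lemma arc_derive_unit_speed (f : R -> vec) (s : R) :
  I s -> arc_derive alpha f s = vderive f s.
Proof. intros hs; unfold arc_derive; rewrite (hunit s hs), Rinv_1; vec_ring. Qed.

Lemma is_vderive_tangent (s : R) : I s -> is_vderive (tangent alpha) s (A 2 s).
Proof.
  intros hs; apply (is_vderive_ext_on I (A 1)); trivial.
  - intros u hu; symmetry; now apply arc_derive_unit_speed.
  - now apply is_vderive_A.
Qed.

Lemma arc_derive_tangent (s : R) : I s -> arc_derive alpha (tangent alpha) s = A 2 s.
Proof.
  intros hs; rewrite arc_derive_unit_speed by easy.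
  now apply is_vderive_unique, is_vderive_tangent.
Qed.

Lemma principal_normal_A (s : R) :
  I s -> principal_normal alpha s = scal (/ enorm (A 2 s)) (A 2 s).
Proof.
  intros hs; unfold principal_normal, curvature; now rewrite arc_derive_tangent.
Qed.

Lemma curvature_pos (s : R) : I s -> 0 < curvature alpha s.
Proof.
  intros hs; destruct hfrenet as (_ & _ & hc).
  generalize (hc s hs), (enorm_ge0 (arc_derive alpha (tangent alpha) s)).
  unfold curvature; lra.
Qed.

Lemma dot_A2_pos (s : R) : I s -> 0 < dot (A 2 s) (A 2 s).
Proof.
  intros hs; generalize (curvature_pos s hs); unfold curvature.
  rewrite arc_derive_tangent by easy; intros h.
  rewrite <- enorm_sqr; nra.
Qed.

(** Written as the quotient of [A 2] by its norm, the normal inherits derivatives from [alpha]. The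
    second one makes [N'] and its norm continuous, as required for the arc length of the indicatrix
    and for the sign argument on slant helices. *)
Lemma principal_normal_C2 (s : R) : I s ->
  is_vderive (principal_normal alpha) s (vderive (principal_normal alpha) s) /\
  exists l, is_vderive (vderive (principal_normal alpha)) s l.
Proof.
  set (r := fun u => / enorm (A 2 u)).
  set (r' := fun u =>
    - (dot (A 2 u) (A 3 u) / enorm (A 2 u)) / enorm (A 2 u) ^ 2).
  set (N1 := fun u => plus (scal (r' u) (A 2 u)) (scal (r u) (A 3 u))).
  assert (hE : forall u, I u -> 0 < enorm (A 2 u))
    by (intros u hu; now apply sqrt_lt_R0, dot_A2_pos).
  assert (hdE : forall u, I u ->
    is_derive (fun u => enorm (A 2 u)) u (dot (A 2 u) (A 3 u) / enorm (A 2 u))).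
  { intros u hu; apply is_derive_enorm; [now apply is_vderive_A|now apply dot_A2_pos]. }
  assert (hr : forall u, I u -> is_derive r u (r' u)).
  { intros u hu; apply (is_derive_inv (fun u => enorm (A 2 u))); [now apply hdE|].
    generalize (hE u hu); lra. }
  assert (h1 : forall u, I u -> is_vderive (principal_normal alpha) u (N1 u)).
  { intros u hu; apply (is_vderive_ext_on I (fun u => scal (r u) (A 2 u))); trivial.
    - intros w hw; symmetry; now apply principal_normal_A.
    - apply is_vderive_scal_fun; [now apply hr|now apply is_vderive_A]. }
  intros hs; split.
  - rewrite (is_vderive_unique _ _ _ (h1 s hs)); now apply h1.
  - assert (hr2 : ex_derive r' s).
    { assert (aux : forall D E : R -> R, ex_derive D s -> ex_derive E s ->
        0 < E s -> ex_derive (fun u => - (D u / E u) / E u ^ 2) s).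
      { intros D E hD hE' hp; auto_derive; repeat split; trivial;
          apply Rgt_not_eq; repeat apply Rmult_lt_0_compat; lra. }
      apply (aux (fun u => dot (A 2 u) (A 3 u)) (fun u => enorm (A 2 u))).
      - eexists; apply is_derive_dot; now apply is_vderive_A.
      - eexists; now apply hdE.
      - now apply hE. }
    destruct hr2 as [r2 hr2].
    eexists; apply (is_vderive_ext_on I N1); trivial.
    + intros u hu; symmetry; now apply is_vderive_unique, h1.
    + apply is_vderive_plus; apply is_vderive_scal_fun;
        [exact hr2|now apply is_vderive_A|now apply hr|now apply is_vderive_A].
Qed.

(** Differentiating [T.T = 1], [N.N = 1] and [T.N = 0] in turn, with [T' = kappa N], gives the last
    three relations. *)
Lemma frenet_relations (s : R) : I s ->
  let T := tangent alpha s in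
  let N := principal_normal alpha s in
  let N' := vderive (principal_normal alpha) s in
  dot T T = 1 /\ dot N N = 1 /\ dot T N = 0 /\
  dot N' N = 0 /\ dot N' T = - curvature alpha s.
Proof.
  intros hs T N N'.
  assert (hTT : forall u, I u -> dot (tangent alpha u) (tangent alpha u) = 1).
  { intros u hu; unfold tangent; rewrite arc_derive_unit_speed by easy.
    rewrite <- enorm_sqr, (hunit u hu); ring. }
  assert (hdT : forall u, I u -> is_vderive (tangent alpha) u
            (scal (curvature alpha u) (principal_normal alpha u))).
  { intros u hu; unfold principal_normal.
    rewrite scal_scal, arc_derive_tangent by easy.
    generalize (curvature_pos u hu); intros hk.
    rewrite Rinv_r by lra.
    replace (scal 1 (A 2 u)) with (A 2 u) by vec_ring; now apply is_vderive_tangent. }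
  assert (hNN : forall u, I u ->
    dot (principal_normal alpha u) (principal_normal alpha u) = 1).
  { intros u hu; rewrite principal_normal_A by easy; autorewrite with dots.
    generalize (sqrt_lt_R0 _ (dot_A2_pos u hu)), (enorm_sqr (A 2 u)).
    fold (enorm (A 2 u)); intros hp <-; field; lra. }
  assert (hTN : forall u, I u -> dot (tangent alpha u) (principal_normal alpha u) = 0).
  { intros u hu.
    generalize (dot_const_derive I _ _ _ u _ _ hI hu hTT (hdT u hu) (hdT u hu)).
    autorewrite with dots; rewrite (dot_comm (principal_normal alpha u)).
    generalize (curvature_pos u hu); nra. }
  destruct (principal_normal_C2 s hs) as [hN _].
  generalize (dot_const_derive I _ _ _ s _ _ hI hs hNN hN hN).
  generalize (dot_const_derive I _ _ _ s _ _ hI hs hTN (hdT s hs) hN).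
  autorewrite with dots. rewrite (hNN s hs).
  fold T N N'; rewrite (dot_comm N N'), (dot_comm T N'); intros e1 e2.
  split; [now apply hTT|split; [now apply hNN|split; [now apply hTN|lra]]].
Qed.

(** From [N' = - kappa T + tau B] one gets [N x N' = tau T + kappa B] and
    [|N'|^2 = tau^2 + kappa^2]. This identifies the Darboux vector with the third vector of the
    Sabban frame of [N]. *)
Lemma unit_darboux_normal (s : R) : I s ->
  let N := principal_normal alpha s in
  let N' := vderive (principal_normal alpha) s in
  0 < enorm N' /\ unit_darboux alpha s = scal (/ enorm N') (cross N N').
Proof.
  intros hs N N'.
  destruct (frenet_relations s hs) as (hTT & hNN & hTN & hN'N & hN'T).
  fold N N' in hNN, hTN, hN'N, hN'T.
  set (T := tangent alpha s) in *. set (k := curvature alpha s) in *.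
  assert (htau : torsion alpha s = dot N' (cross T N)).
  { unfold torsion; now rewrite arc_derive_unit_speed. }
  set (tau := torsion alpha s) in *.
  generalize (orthonormal_expansion T N N' hTT hNN hTN).
  rewrite hN'N, hN'T, <- htau; intros e.
  assert (hBB : dot (cross T N) (cross T N) = 1)
    by (rewrite dot_cross_cross, hTT, hNN, hTN; ring).
  assert (hsq : dot N' N' = tau ^ 2 + k ^ 2).
  { rewrite e at 2; autorewrite with dots; rewrite hN'T, hN'N, <- htau; ring. }
  generalize (curvature_pos s hs); fold k; intros hk.
  split; [apply sqrt_lt_R0; rewrite hsq; nra|].
  unfold unit_darboux, binormal; fold T k tau N.
  unfold enorm; rewrite hsq; f_equal.
  rewrite e.
  transitivity (plus (scal k (cross T N)) (scal tau (cross N (cross T N)))).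
  - rewrite cross_cross_r, hNN, (dot_comm N T), hTN; vec_ring.
  - vec_ring.
Qed.

End Frenet.

(** * Slant helices and the Sabban frame of their normal indicatrix *)

(* [N'] is orthogonal to both [N] and [u], hence a multiple of [cross u N]; the
   sign of the multiple cannot change on an interval. *)
Lemma slant_normal_derive (I : R -> Prop) (alpha : R -> vec) (u : vec) (phi : R) :
  interval_open I -> I 0 -> unit_speed I alpha -> frenet_curve I alpha ->
  enorm u = 1 -> (forall t, I t -> dot (principal_normal alpha t) u = cos phi) ->
  exists lam, forall s, I s ->
    lam * lam * (1 - cos phi * cos phi) = 1 /\
    let N := principal_normal alpha in
    vderive N s = scal (enorm (vderive N s) * lam) (cross u (N s)).
Proof.
  intros hI h0 hunit hfr hu hphi.
  set (N := principal_normal alpha). set (N' := vderive N).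
  set (w := fun s => cross u (N s)).
  assert (huu : dot u u = 1) by (rewrite <- enorm_sqr, hu; ring).
  assert (hC2 := principal_normal_C2 I alpha (proj1 hI) hunit hfr).
  assert (hrho : forall s, I s -> 0 < enorm (N' s)).
  { intros s hs; now apply (unit_darboux_normal I alpha (proj1 hI) hunit hfr). }
  assert (hNN : forall s, I s -> dot (N s) (N s) = 1)
    by (intros s hs; destruct (frenet_relations I alpha (proj1 hI) hunit hfr s hs)
      as (_ & h & _); exact h).
  assert (hN'N : forall s, I s -> dot (N' s) (N s) = 0)
    by (intros s hs; destruct (frenet_relations I alpha (proj1 hI) hunit hfr s hs)
      as (_ & _ & _ & h & _); exact h).
  assert (hN'u : forall s, I s -> dot (N' s) u = 0).
  { intros s hs; destruct (hC2 s hs) as [hN _].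
    generalize (dot_const_derive I N (fun _ => u) _ s _ _ (proj1 hI) hs hphi hN
                  (is_vderive_const u s)).
    fold N N'; rewrite (dot_comm (N s)), dot_zero_l; lra. }
  (* [S2] is [sin^2 phi], the squared length of [u x N]. *)
  set (S2 := 1 - cos phi * cos phi).
  assert (hww : forall s, I s -> dot (w s) (w s) = S2).
  { intros s hs; unfold w, S2.
    rewrite dot_cross_cross, huu, hNN, (dot_comm u), hphi by easy; ring. }
  (* If it vanished, [N] would be the constant vector [cos phi u], against [N' <> 0] at the
     parameter 0. *)
  assert (hS2 : 0 < S2).
  { destruct (Rle_lt_or_eq_dec 0 S2) as [|e]; trivial.
    - rewrite <- (hww 0 h0); apply dot_self_ge0.
    - exfalso.
      assert (hc : forall s, I s -> N s = scal (cos phi) u).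
      { intros s hs.
        assert (hz : plus (N s) (scal (- cos phi) u) = zero :> vec).
        { apply dot_self_eq0; autorewrite with dots.
          rewrite (dot_comm u (N s)), hphi, hNN, huu by easy; unfold S2 in e; lra. }
        transitivity (plus (plus (N s) (scal (- cos phi) u)) (scal (cos phi) u)).
        - vec_ring.
        - rewrite hz; vec_ring. }
      assert (hz : N' 0 = zero).
      { apply is_vderive_unique.
        apply (is_vderive_ext_on I (fun _ => scal (cos phi) u)); trivial.
        - apply hI.
        - intros s hs; symmetry; now apply hc.
        - apply is_vderive_const. }
      generalize (hrho 0 h0); rewrite hz; unfold enorm.
      rewrite dot_zero_l, sqrt_0; lra. }
  set (eta := fun s => dot (N' s) (w s)).
  (* [N' x w = (N'.N) u - (N'.u) N] is zero; taking its product with [w] once more expresses [N']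
     through [w]. *)
  assert (hpar : forall s, I s -> scal S2 (N' s) = scal (eta s) (w s)).
  { intros s hs.
    assert (hz : cross (N' s) (w s) = zero).
    { unfold w; rewrite cross_cross_r, hN'N, hN'u by easy; vec_ring. }
    generalize (cross_cross_l (N' s) (w s) (w s)).
    rewrite hz, (hww s hs); fold (eta s).
    intros e. symmetry.
    transitivity (plus (plus (scal (eta s) (w s)) (scal (- S2) (N' s)))
                    (scal S2 (N' s))); [vec_ring|].
    rewrite <- e; vec_ring. }
  assert (heta : forall s, I s -> eta s * eta s = enorm (N' s) * enorm (N' s) * S2).
  { intros s hs; rewrite enorm_sqr.
    generalize (f_equal (fun x => dot x (N' s)) (hpar s hs)).
    autorewrite with dots; rewrite (dot_comm (w s)); fold (eta s); lra. }
  (* The cosine of the angle between the parallel vectors [N'] and [w], hence a sign. *)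
  set (q := fun s => eta s / (enorm (N' s) * sqrt S2)).
  generalize (sqrt_lt_R0 _ hS2), (sqrt_sqrt S2 (Rlt_le _ _ hS2)); intros hr hrr.
  assert (hqq : forall s, I s -> q s * q s = 1).
  { intros s hs; generalize (hrho s hs), (heta s hs); intros hp e.
    unfold q; transitivity (eta s * eta s /
      (enorm (N' s) * enorm (N' s) * (sqrt S2 * sqrt S2))); [field; lra|].
    rewrite e, hrr; field; lra. }
  assert (hq : forall s, I s -> q s = q 0).
  { intros s hs; apply (unit_square_const I q); trivial; clear s hs.
    intros s hs; apply continuity_pt_filterlim.
    apply (ex_derive_continuous (V := R_NormedModule)).
    destruct (hC2 s hs) as [hN [l hN']].
    assert (hN'p : 0 < dot (N' s) (N' s))
      by (rewrite <- enorm_sqr; generalize (hrho s hs); nra).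
    assert (h1 : ex_derive eta s).
    { eexists; apply is_derive_dot; [exact hN'|].
      apply is_vderive_cross; [apply is_vderive_const|exact hN]. }
    assert (h2 : ex_derive (fun s => enorm (N' s)) s).
    { eexists; apply is_derive_enorm; [exact hN'|exact hN'p]. }
    assert (aux : forall f g : R -> R, ex_derive f s -> ex_derive g s ->
      0 < g s -> ex_derive (fun r => f r / (g r * sqrt S2)) s).
    { intros f g hf hg hp; auto_derive; repeat split; trivial.
      apply Rgt_not_eq, Rmult_lt_0_compat; lra. }
    apply (aux eta (fun s => enorm (N' s))); auto. }
  (* The factor [/ sqrt S2] normalises [u x N]; [q 0] is its constant sign relative to [N']. *)
  exists (q 0 / sqrt S2); intros s hs; split.
  - transitivity (q 0 * q 0 / (sqrt S2 * sqrt S2) * S2);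
      [fold S2; field; lra|].
    rewrite hqq, hrr by easy; field; lra.
  - cbv zeta. fold N' (w s).
    transitivity (scal (/ S2) (scal S2 (N' s))).
    + rewrite scal_scal, Rinv_l by lra; vec_ring.
    + rewrite hpar, scal_scal by easy; f_equal.
      rewrite <- (hq s hs); unfold q; rewrite <- hrr at 1.
      generalize (hrho s hs); intros; field; lra.
Qed.

(** Passing from [s] to [sigma] divides by [rho = |N'|], which cancels the speed in the slant
    relation and leaves [dN/dsigma = lam (u x N)]. The function [s_of] performs the change of
    parameter. *)
Lemma slant_helix_sabban (I : R -> Prop) (alpha : R -> vec) (s_of : R -> R) :
  interval_open I -> I 0 -> unit_speed I alpha -> slant_helix I alpha ->
  (forall s, I s -> s_of (normal_arclength alpha s) = s) ->
  let J := image_on I (normal_arclength alpha) in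
  let N := fun sigma => principal_normal alpha (s_of sigma) in
  interval_open J /\
  exists t k, sabban_frame J N t k /\
    forall sigma, J sigma -> unit_darboux alpha (s_of sigma) = cross (N sigma) (t sigma).
Proof.
  intros hI h0 hunit [hfr (u & phi & hu & hphi)] hs_of J N.
  set (P := principal_normal alpha) in *.
  set (rho := fun s => enorm (vderive P s)).
  assert (hC2 := principal_normal_C2 I alpha (proj1 hI) hunit hfr).
  assert (hdar := unit_darboux_normal I alpha (proj1 hI) hunit hfr).
  assert (hrho : forall s, I s -> 0 < rho s) by (intros s hs; now apply hdar).
  assert (hNN : forall s, I s -> dot (P s) (P s) = 1)
    by (intros s hs; destruct (frenet_relations I alpha (proj1 hI) hunit hfr s hs)
      as (_ & h & _); exact h).
  (* The integrand [rho] is continuous because [N'] is differentiable and does not vanish. *)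
  assert (hsig : forall s, I s -> is_derive (normal_arclength alpha) s (rho s)).
  { intros s hs; apply (is_derive_integral I rho 0 s hI); trivial.
    intros r hr; destruct (hC2 r hr) as [_ [l hl]].
    apply (ex_derive_continuous (V := R_NormedModule)); eexists.
    apply is_derive_enorm; [exact hl|].
    rewrite <- enorm_sqr; generalize (hrho r hr); unfold rho; fold P; nra. }
  split; [now apply (image_interval_open I _ rho)|].
  destruct (slant_normal_derive I alpha u phi hI h0 hunit hfr hu hphi) as [lam hlam].
  fold P in hlam; cbv zeta in hlam.
  assert (huu : dot u u = 1) by (rewrite <- enorm_sqr, hu; ring).
  (* [lam * cos phi] is the geodesic curvature, up to sign [cot phi], of the circle of angular
     radius [phi] about [u]. *)
  exists (fun sigma => scal lam (cross u (N sigma))), (lam * cos phi).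
  split.
  - intros sigma [s [hs <-]].
    assert (hN : is_vderive N (normal_arclength alpha s)
                   (scal lam (cross u (N (normal_arclength alpha s))))).
    { assert (hinv := is_derive_left_inverse I _ rho s_of s hI hsig hrho hs_of hs).
      assert (hP : is_vderive P (s_of (normal_arclength alpha s)) (vderive P s))
        by (rewrite hs_of by easy; now apply hC2).
      generalize (is_vderive_comp P s_of _ _ _ hP hinv).
      match goal with |- is_vderive _ _ ?l -> is_vderive _ _ ?m =>
        replace l with m; [easy|] end.
      unfold N; rewrite hs_of by easy; fold P.
      destruct (hlam s hs) as [_ e]; rewrite e, scal_scal; fold (rho s).
      f_equal. generalize (hrho s hs); intros; field; lra. }
    assert (ht := is_vderive_scal lam _ _ _
                    (is_vderive_cross _ _ _ _ _ (is_vderive_const u _) hN)).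
    assert (hn1 : dot (N (normal_arclength alpha s)) (N (normal_arclength alpha s)) = 1)
      by (unfold N; rewrite hs_of by easy; now apply hNN).
    assert (hnu : dot (N (normal_arclength alpha s)) u = cos phi)
      by (unfold N; rewrite hs_of by easy; now apply hphi).
    revert hN ht hn1 hnu; cbv beta.
    generalize (N (normal_arclength alpha s)); intros n hN ht hn1 hnu.
    destruct (hlam s hs) as [hl _].
    split; [easy|split; [|split; [|split; [exact hN|]]]].
    + autorewrite with dots; rewrite dot_cross_cross, huu, hn1, (dot_comm u), hnu; lra.
    + autorewrite with dots; rewrite dot_cross_r; ring.
    + revert ht.
      match goal with |- is_vderive _ _ ?l -> is_vderive _ _ ?m =>
        replace l with m; [easy|] end.
      replace (plus (cross zero n) (cross u (scal lam (cross u n))))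
        with (scal lam (cross u (cross u n))) by vec_ring.
      rewrite !cross_scal_r, !cross_cross_r, huu, hn1, (dot_comm u), hnu.
      (* [lam * lam * (1 - cos phi ^ 2) = 1] gives the coefficient of [n]. *)
      transitivity (plus (scal (- (lam * lam * (1 - cos phi * cos phi))) n)
        (scal (lam * cos phi) (scal lam (plus (scal 1 u) (scal (- cos phi) n))))).
      * now rewrite hl.
      * vec_ring.
  - intros sigma [s [hs <-]].
    unfold N; rewrite hs_of by easy; fold P.
    destruct (hdar s hs) as [hp ->]; fold P in hp |- *.
    destruct (hlam s hs) as [_ e].
    (* Replacing [N'] by [rho lam (u x N)] in the Darboux vector cancels [rho] and leaves
       [N x t]. *)
    transitivity (scal (/ rho s) (cross (P s) (scal (rho s * lam) (cross u (P s))))).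
    + unfold rho; now rewrite <- e.
    + rewrite !cross_scal_r, scal_scal; f_equal.
      generalize (hrho s hs); intros; field; lra.
Qed.

(** * The curve [gamma_tilde] *)

(** The velocity is [a N + a cot theta C], so the results on Sabban frames apply. Non-planarity
    keeps the constant torsion away from zero: for [cot theta = - k] the curve is an arc of a
    circle. *)
Theorem corollary4
    (I : R -> Prop) (alpha : R -> vec)
    (hI : interval_open I) (hI0 : I 0)
    (hunit : unit_speed I alpha) (hslant : slant_helix I alpha)
    (s_of : R -> R)
    (hs_of : forall s, I s -> s_of (normal_arclength alpha s) = s)
    (a theta : R) (htheta : sin theta <> 0) (c : vec) (sigma0 : R)
    (hsigma0 : image_on I (normal_arclength alpha) sigma0) :
  let J := image_on I (normal_arclength alpha) in
  let N := fun sigma => principal_normal alpha (s_of sigma) in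
  let C := fun sigma => unit_darboux alpha (s_of sigma) in
  let gamma := gamma_tilde N C a theta c sigma0 in
  regular_on J gamma -> curved_on J gamma ->
  bertrand_curve J gamma /\ (~ plane_curve J gamma -> circular_helix J gamma).
Proof.
  intros J N C gamma _ hcurved.
  destruct (slant_helix_sabban I alpha s_of hI hI0 hunit hslant hs_of)
    as [hJ (t & k & frame & hC)].
  fold J N in hJ, frame.
  change (forall s, J s -> C s = cross (N s) (t s)) in hC.
  set (q := a * (cos theta / sin theta)).
  assert (hg : forall s, J s ->
    is_vderive gamma s (plus (scal a (N s)) (scal q (cross (N s) (t s))))).
  { intros s hs; rewrite <- (hC s hs).
    assert (hN : is_vderive (vint N sigma0) s (N s)).
    { apply (is_vderive_vint J); trivial.
      intros r hr; exists (t r); now apply frame. }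
    assert (hCd : is_vderive (vint C sigma0) s (C s)).
    { apply (is_vderive_vint J); trivial.
      intros r hr; exists (scal (- k) (t r)).
      (* On [J] the Darboux vector agrees with [N x t], whose differentiability is known; continuity
         of the integrand follows. *)
      apply (is_vderive_ext_on J (fun w => cross (N w) (t w))); trivial.
      - apply hJ.
      - intros w hw; now rewrite <- hC.
      - now apply (is_vderive_sabban_C J N t k frame). }
    generalize (is_vderive_plus _ _ _ _ _
      (is_vderive_plus _ _ _ _ _ (is_vderive_scal a _ _ _ hN)
                                 (is_vderive_scal q _ _ _ hCd))
      (is_vderive_const c s)).
    match goal with |- is_vderive _ _ ?l -> is_vderive _ _ ?m =>
      replace l with m; [easy|unfold C; vec_ring] end. }
  (* As [a], [k] and [q] are constants, non-zero curvature at the single parameter [sigma0] is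
     enough. *)
  assert (hpq : a - k * q <> 0).
  { apply (sabban_curve_curved J N t k (proj1 hJ) frame gamma a q hg sigma0); trivial.
    now apply hcurved. }
  split.
  - exact (sabban_curve_bertrand J N t gamma k a q (proj1 hJ) frame hg hpq).
  - apply (sabban_curve_helix J N t gamma k a q hJ frame hg hpq).
    now exists sigma0.
Qed.
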